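(* Let $x,z\in\mathbb{R}^n$ and $y,w\in\mathbb{R}^m$. Then the following statements are equivalent: (1) $x\prec z$ and $y\prec w$. (2) $(x,y)$ is obtained from $(z,w)$ by a finite sequence of block $T$-transforms. (3) $(x,y)$ lies in the convex hull of all vectors obtained from $(z,w)$ by permuting coordinates within the first block (the first $n$ coordinates) and within the second block (the last $m$ coordinates). (4) For some doubly stochastic matrices $A_1\in\mathbb{R}^{n\times n}$ and $A_2\in\mathbb{R}^{m\times m}$, we have $(x,y)^T=(A_1\oplus A_2)(z,w)^T$.
   Context: For a real vector $x$, $x^{\downarrow}$ denotes its non-increasing rearrangement. For $a,b\in\mathbb{R}^p$, $a\prec b$ (majorization) means $\sum_{i=1}^k a_i^{\downarrow}\le\sum_{i=1}^k b_i^{\downarrow}$ for $1\le k\le p$, with equality for $k=p$. A linear map $T:\mathbb{R}^p\to\mathbb{R}^p$ is a (classical) $T$-transform if there exist indices $j\ne k$ and $t\in[0,1]$ such that $Ty$ has $j$-th coordinate $ty_j+(1-t)y_k$, $k$-th coordinate $(1-t)y_j+ty_k$, and all other coordinates equal to those of $y$. A linear map $T:\mathbb{R}^{n+m}\to\mathbb{R}^{n+m}$ is a block $T$-transform if either $T=T_1\oplus I_m$ with $T_1$ a $T$-transform on $\mathbb{R}^n$, or $T=I_n\oplus T_2$ with $T_2$ a $T$-transform on $\mathbb{R}^m$. A finite sequence may be empty. A square real matrix is doubly stochastic if its entries are nonnegative and all row and column sums equal $1$. $A_1\oplus A_2$ is the block diagonal matrix with diagonal blocks $A_1,A_2$. 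*)

(* Defs.v *)
From Stdlib Require List.
From HB Require Import structures.
From mathcomp Require Import all_boot all_order all_algebra perm.
From mathcomp Require Import boolp classical_sets reals convex.

Set Implicit Arguments.
Unset Strict Implicit.
Unset Printing Implicit Defensive.

Import Order.TTheory GRing.Theory Num.Theory.

Local Open Scope classical_set_scope.
Local Open Scope ring_scope.

(* Vectors of R^p are row vectors 'rV[R]_p, and (x, y) is row_mx x y. *)

Definition decr_rearr (R : realType) (p : nat) (x : 'rV[R]_p) : 'rV[R]_p :=
  \row_(i < p) (sort >=%R [seq x 0 j | j <- enum 'I_p])`_i.

Definition majorized (R : realType) (p : nat) (a b : 'rV[R]_p) : Prop :=
  (forall k : nat, (1 <= k <= p)%N ->
     \sum_(i < p | (i < k)%N) decr_rearr a 0 i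
       <= \sum_(i < p | (i < k)%N) decr_rearr b 0 i)
  /\ \sum_(i < p) decr_rearr a 0 i = \sum_(i < p) decr_rearr b 0 i.

Definition T_transform (R : realType) (p : nat)
    (T : {linear 'rV[R]_p -> 'rV[R]_p}) : Prop :=
  exists (j k : 'I_p) (t : R),
    [/\ j != k, 0 <= t <= 1 &
     forall y : 'rV[R]_p,
       [/\ T y 0 j = t * y 0 j + (1 - t) * y 0 k,
           T y 0 k = (1 - t) * y 0 j + t * y 0 k &
           forall i : 'I_p, i != j -> i != k -> T y 0 i = y 0 i]].

(* The two disjuncts are T = T1 (+) I_m and T = I_n (+) T2. *)
Definition block_T_transform (R : realType) (n m : nat)
    (T : {linear 'rV[R]_(n + m) -> 'rV[R]_(n + m)}) : Prop :=
  (exists T1 : {linear 'rV[R]_n -> 'rV[R]_n}, T_transform T1 /\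
     forall (u : 'rV[R]_n) (v : 'rV[R]_m), T (row_mx u v) = row_mx (T1 u) v)
  \/
  (exists T2 : {linear 'rV[R]_m -> 'rV[R]_m}, T_transform T2 /\
     forall (u : 'rV[R]_n) (v : 'rV[R]_m), T (row_mx u v) = row_mx u (T2 v)).

(* b is transformed by the maps of Ts, applied from left to right. *)
Definition block_T_obtained (R : realType) (n m : nat)
    (a b : 'rV[R]_(n + m)) : Prop :=
  exists Ts : seq {linear 'rV[R]_(n + m) -> 'rV[R]_(n + m)},
    List.Forall (@block_T_transform R n m) Ts
    /\ a = foldl (fun (v : 'rV[R]_(n + m))
                      (T : {linear 'rV[R]_(n + m) -> 'rV[R]_(n + m)}) => T v)
                 b Ts.

Definition block_permutations (R : realType) (n m : nat)
    (z : 'rV[R]_n) (w : 'rV[R]_m) : set 'rV[R]_(n + m) :=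
  [set v | exists (s : 'S_n) (t : 'S_m),
             v = row_mx (col_perm s z) (col_perm t w)].

(* The intersection of all convex sets containing A. *)
Definition convex_hull (R : realType) (E : lmodType R) (A : set E) : set E :=
  smallest (fun C : set E => @convex_set R E C) A.

Definition doubly_stochastic (R : realType) (p : nat) (A : 'M[R]_p) : Prop :=
  [/\ forall i j, 0 <= A i j,
      forall i, \sum_j A i j = 1 &
      forall j, \sum_i A i j = 1].

(* Main.v *)
(* The implications are proved in the cycle (1) => (2) => (3) => (4) => (1).
   A T-transform is a convex combination of the identity and a transposition, so
   it preserves the convex hull of the block permutations; block diagonal doubly
   stochastic matrices form a convex set containing the block permutation
   matrices.  The substance is in (1) => (2), which is Muirhead's argument on
   decreasingly rearranged vectors, and in (4) => (1), where a prefix sum of x is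
   a combination of the coordinates of z with weights in [0, 1] of total k. *)

Require Import Defs.
From Stdlib Require Import Relation_Operators.
From Stdlib Require List.
From HB Require Import structures.
From mathcomp Require Import all_boot all_order all_algebra perm.
From mathcomp Require Import boolp classical_sets reals convex.
From mathcomp Require Import interval_inference.
From mathcomp Require Import ring lra.

Import Order.TTheory GRing.Theory Num.Theory.
Local Open Scope classical_set_scope.
Local Open Scope ring_scope.

(** * Decreasing rearrangements *)

Lemma decr_rearrP {R : realType} {p : nat} (x : 'rV[R]_p) :
  exists s : 'S_p, decr_rearr x = col_perm s x.
Proof.
have /tuple_permP[s xs] :
    perm_eq (sort >=%R [seq x 0 j | j <- enum 'I_p]) [tuple x 0 i | i < p].
  by rewrite perm_sort.
exists s; apply/rowP => i; rewrite !mxE xs -[X in nth _ _ X]/(val i) -tnth_nth.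
by rewrite !tnth_mktuple.
Qed.

Lemma decr_rearr_antitone {R : realType} {p : nat} (x : 'rV[R]_p) (i j : 'I_p) :
  (i <= j)%N -> decr_rearr x 0 j <= decr_rearr x 0 i.
Proof.
move=> ij; rewrite !mxE.
have sz : size (sort >=%R [seq x 0 j | j <- enum 'I_p]) = p.
  by rewrite size_sort size_map size_enum_ord.
apply: (sorted_leq_nth ge_trans ge_refl 0 (sort_sorted ge_total _)) => //;
  by rewrite inE sz.
Qed.

(** * Doubly stochastic matrices *)

Lemma doubly_stochastic_perm {R : realType} {p : nat} (s : 'S_p) :
  doubly_stochastic (perm_mx s : 'M[R]_p).
Proof.
have row1 (u : 'S_p) i : \sum_j (perm_mx u : 'M[R]_p) i j = 1.
  rewrite (bigD1 (u i)) //= !mxE eqxx big1 ?addr0 // => j /negPf uij.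
  by rewrite !mxE eq_sym uij.
split=> [i j|//|j]; first by rewrite !mxE ler0n.
by rewrite -[RHS](row1 s^-1%g j) -tr_perm_mx; apply: eq_bigr => i _; rewrite !mxE.
Qed.

Lemma doubly_stochastic_conv {R : realType} {p : nat} (t : R) (A B : 'M[R]_p) :
  0 <= t <= 1 -> doubly_stochastic A -> doubly_stochastic B ->
  doubly_stochastic (t *: A + (1 - t) *: B).
Proof.
move=> /andP[t0 t1] [A0 Ar Ac] [B0 Br Bc]; split=> [i j|i|j].
- by rewrite !mxE addr_ge0 // mulr_ge0 // subr_ge0.
- under eq_bigr do rewrite !mxE.
  by rewrite big_split -!mulr_sumr /= Ar Br; ring.
- under eq_bigr do rewrite !mxE.
  by rewrite big_split -!mulr_sumr /= Ac Bc; ring.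
Qed.

(* Every term of [\sum_j (\sum_(i < k) B i j - [j < k]) * (c j - c (k - 1))] is
   nonpositive, and subtracting [c (k - 1)] does not change this sum since the
   first factors add up to 0. *)
Lemma doubly_stochastic_prefix_sum {R : realType} {p : nat} (B : 'M[R]_p)
    (a c : 'I_p -> R) (k : nat) :
  doubly_stochastic B -> (forall i j : 'I_p, (i <= j)%N -> c j <= c i) ->
  (forall i, a i = \sum_j B i j * c j) -> (1 <= k <= p)%N ->
  \sum_(i < p | (i < k)%N) a i <= \sum_(i < p | (i < k)%N) c i.
Proof.
move=> [B0 Br Bc] anti aE /andP[k1 kp].
have kp1 : (k.-1 < p)%N by rewrite prednK.
pose m := c (Ordinal kp1).
pose C j := \sum_(i < p | (i < k)%N) B i j.
have C0 j : 0 <= C j by apply: sumr_ge0.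
have C1 j : C j <= 1.
  rewrite -(Bc j) [leRHS](bigID (fun i : 'I_p => (i < k)%N)) /= lerDl.
  exact: sumr_ge0.
have aC : \sum_(i < p | (i < k)%N) a i = \sum_j C j * c j.
  under eq_bigr do rewrite aE.
  by rewrite exchange_big; apply: eq_bigr => j _; rewrite mulr_suml.
have CE : \sum_j C j = \sum_(j < p) (j < k)%N%:R.
  rewrite exchange_big big_mkcond /=.
  by apply: eq_bigr => i _; case: ifP => // _; rewrite Br.
rewrite -subr_le0 aC [X in _ - X]big_mkcond -sumrB.
have -> : \sum_j (C j * c j - (if (j < k)%N then c j else 0)) =
          \sum_j (C j - (j < k)%N%:R) * (c j - m).
  rewrite [RHS](eq_bigr (fun j : 'I_p =>
    (C j * c j - (if (j < k)%N then c j else 0)) - (C j - (j < k)%N%:R) * m)).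
    by rewrite [RHS]sumrB -mulr_suml [X in _ - X * m]sumrB CE subrr mul0r subr0.
  by move=> j _; case: ifP => _ /=; ring.
(* The factors have opposite signs: for [j < k], [C j <= 1] while [c j >= m]; otherwise [C j >= 0]
   while [c j <= m]. *)
apply: sumr_le0 => j _; case: ltnP => jk.
  apply: mulr_le0_ge0; first by rewrite subr_le0.
  by rewrite subr_ge0 anti //= -ltnS prednK.
rewrite subr0 mulr_ge0_le0 // subr_le0 anti //=.
exact: leq_trans (leq_pred k) jk.
Qed.

(** Permuting the rows and columns of [A] keeps it doubly stochastic and turns it into a matrix
    sending [decr_rearr z] to [decr_rearr x], so the prefix sum bound applies. Column sums give
    equality of the totals. *)
Lemma doubly_stochastic_majorized {R : realType} {p : nat} (A : 'M[R]_p)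
    (x z : 'rV[R]_p) :
  doubly_stochastic A -> x^T = A *m z^T -> majorized x z.
Proof.
move=> [A0 Ar Ac] xA.
have xE i : x 0 i = \sum_j A i j * z 0 j.
  by move/colP/(_ i): xA; rewrite !mxE => ->; apply: eq_bigr => j _; rewrite mxE.
have [s xs] := decr_rearrP x; have [t zt] := decr_rearrP z.
have zanti := @decr_rearr_antitone R p z.
split.
  move=> k kp.
  apply: (@doubly_stochastic_prefix_sum _ _ (\matrix_(i, j) A (s i) (t j))) => //.
    split=> [i j|i|j]; first by rewrite mxE.
      under eq_bigr do rewrite mxE.
      by rewrite -[RHS](Ar (s i)) [RHS](reindex_perm t).
    under eq_bigr do rewrite mxE.
    by rewrite -[RHS](Ac (t j)) [RHS](reindex_perm s).
  move=> i; rewrite xs zt mxE xE (reindex_perm t) /=.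
  by apply: eq_bigr => j _; rewrite !mxE.
rewrite xs zt; under eq_bigr do rewrite mxE.
under [RHS]eq_bigr do rewrite mxE.
have total (u : 'S_p) (v : 'rV[R]_p) : \sum_i v 0 (u i) = \sum_i v 0 i.
  by rewrite [RHS](reindex_perm u).
rewrite !total.
under eq_bigr do rewrite xE.
rewrite exchange_big; apply: eq_bigr => j _.
by rewrite -mulr_suml Ac mul1r.
Qed.

(** * T-transforms *)

(** A relation from the old vector to the new one, so that finite sequences become its reflexive
    transitive closure. *)
Definition T_step {R : realType} {p : nat} (b a : 'rV[R]_p) : Prop :=
  exists (j k : 'I_p) (t : R),
    [/\ j != k, 0 <= t <= 1 & a = t *: b + (1 - t) *: col_perm (tperm j k) b].

Lemma T_transform_step {R : realType} {p : nat}
    (T : {linear 'rV[R]_p -> 'rV[R]_p}) :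
  T_transform T -> exists (j k : 'I_p) (t : R), 0 <= t <= 1 /\
    forall y, T y = t *: y + (1 - t) *: col_perm (tperm j k) y.
Proof.
move=> [j [k [t [jk t01 TE]]]]; exists j, k, t; split=> // y.
have [Tj Tk Ti] := TE y.
apply/rowP => i; rewrite !mxE.
case: tpermP => [->|->|/eqP ij /eqP ik]; rewrite ?Tj ?Tk ?Ti //; ring.
Qed.

(** The map is given as a matrix so that it can later serve as a diagonal block. *)
Lemma T_step_transform {R : realType} {p : nat} (b a : 'rV[R]_p) :
  T_step b a ->
  exists A : 'M[R]_p,
    T_transform (mulmxr A : {linear 'rV[R]_p -> 'rV[R]_p}) /\ a = b *m A.
Proof.
move=> [j [k [t [jk t01 ->]]]].
pose A : 'M[R]_p := t%:M + (1 - t) *: perm_mx (tperm j k).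
have AE (y : 'rV_p) : y *m A = t *: y + (1 - t) *: col_perm (tperm j k) y.
  by rewrite mulmxDr mul_mx_scalar -scalemxAr col_permE tpermV.
exists A; split; last by rewrite AE.
exists j, k, t; split=> // y; rewrite /mulmxr /= AE.
split=> [||i ij ik]; rewrite !mxE ?tpermL ?tpermR //; first by ring.
by rewrite tpermD 1?eq_sym //; ring.
Qed.

(** A permutation is a product of transpositions, and a transposition is the step with [t = 0]. *)
Lemma T_steps_perm {R : realType} {p : nat} (s : 'S_p) (b : 'rV[R]_p) :
  clos_refl_trans _ T_step b (col_perm s b).
Proof.
have [ts -> dts] := prod_tpermP s.
elim: ts dts => [_|[j k] ts IH] /=.
  by rewrite big_nil col_perm1; apply: rt_refl.
move=> /andP[jk /IH bts]; rewrite big_cons col_permM.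
apply: rt_trans bts _; apply: rt_step; exists j, k, 0.
by rewrite jk lexx ler01 scale0r add0r subr0 scale1r.
Qed.

Lemma T_step_transfer {R : realType} {p : nat} (b : 'rV[R]_p) (j k : 'I_p)
    (d : R) :
  j != k -> 0 <= d -> d < b 0 j - b 0 k ->
  T_step b (\row_i (b 0 i - d * (i == j)%:R + d * (i == k)%:R)).
Proof.
move=> jk d0 db.
have g0 : 0 < b 0 j - b 0 k by apply: le_lt_trans db.
(* A step with parameter [t] moves [(1 - t) * (b 0 j - b 0 k)] from coordinate [j] to [k]; this [t]
   makes that amount [d]. *)
exists j, k, (1 - d / (b 0 j - b 0 k)); split=> //.
  rewrite subr_ge0 ler_pdivrMr // mul1r ltW //= lerBlDr lerDl.
  by rewrite divr_ge0 // ltW.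
have dE : d = d / (b 0 j - b 0 k) * (b 0 j - b 0 k) by rewrite divfK ?gt_eqF.
set q := d / _ in dE *.
apply/rowP => i; rewrite !mxE.
case: tpermP => [->|->|/eqP/negPf-> /eqP/negPf->].
- by rewrite eqxx (negPf jk) /= dE; ring.
- by rewrite eqxx eq_sym (negPf jk) /= dE; ring.
- by rewrite /=; ring.
Qed.

(* Take [k] minimal with [b k < a k]; the prefix sum up to [k] yields [j < k]
   with [a j < b j].  Moving [min (b j - a j) (a k - b k)] from [b j] to [b k] is
   a T-transform since [b k < a k <= a j < b j]; it fixes one of these two
   coordinates and preserves the hypotheses. *)
Lemma prefix_sum_le_T_steps {R : realType} {p : nat} (a b : 'rV[R]_p) :
  (forall i j : 'I_p, (i <= j)%N -> a 0 j <= a 0 i) ->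
  (forall k : nat, (1 <= k <= p)%N ->
     \sum_(i < p | (i < k)%N) a 0 i <= \sum_(i < p | (i < k)%N) b 0 i) ->
  \sum_(i < p) a 0 i = \sum_(i < p) b 0 i ->
  clos_refl_trans _ T_step b a.
Proof.
move=> anti.
(* Induction on the number of coordinates where [a] and [b] differ. *)
have [N] := ubnP #|[set i | a 0 i != b 0 i]%SET|.
elim: N b => // N IH b; rewrite ltnS => cardN le_ab eq_ab.
have [->|neq_ab] := eqVneq a b; first exact: rt_refl.
(* Otherwise all [b 0 i - a 0 i] are nonnegative with sum 0, forcing [a = b]. *)
have [i0 i0P] : exists i, b 0 i < a 0 i.
  apply/not_existsP => le; case/eqP: neq_ab; apply/rowP => i.
  have ge i' : true -> 0 <= b 0 i' - a 0 i'.
    by move=> _; rewrite subr_ge0 leNgt; apply/negP/le.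
  have /psumr_eq0P : \sum_i (b 0 i - a 0 i) = 0 by rewrite sumrB eq_ab subrr.
  by move=> /(_ ge i isT) /eqP; rewrite subr_eq0 => /eqP.
pose k := [arg min_(i < i0 | (b 0 i < a 0 i)%R) i]%N.
have [bak kmin] : b 0 k < a 0 k /\ forall i : 'I_p, (i < k)%N -> a 0 i <= b 0 i.
  rewrite /k; case: arg_minnP => // k' bak kmin; split=> // i.
  by rewrite ltnNge leNgt; apply: contra => /kmin.
(* Otherwise the prefix of length [k.+1], which includes [k], would have a larger sum in [a] than in
   [b]. *)
have [j jk abj] : exists2 j : 'I_p, (j < k)%N & a 0 j < b 0 j.
  apply/not_exists2P => no.
  have ge (i : 'I_p) : (i < k)%N -> b 0 i <= a 0 i.
    by move=> ik; rewrite leNgt; apply/negP; case: (no i).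
  have := le_ab k.+1 (ltn_ord k); apply/negP; rewrite -ltNge.
  rewrite [ltLHS](bigD1 k) //= [ltRHS](bigD1 k) //=.
  apply: ltr_leD => //; apply: ler_sum => i /andP[]; rewrite ltnS => ik nik.
  by rewrite ge // ltn_neqAle ik andbT.
have ajk : a 0 k <= a 0 j by apply: anti; apply: ltnW.
have neq_jk : j != k by rewrite neq_ltn jk.
pose d := Num.min (b 0 j - a 0 j) (a 0 k - b 0 k).
have d0 : 0 < d by rewrite lt_min !subr_gt0 abj bak.
have dj : d <= b 0 j - a 0 j by rewrite ge_min lexx.
have dk : d <= a 0 k - b 0 k by rewrite ge_min lexx orbT.
pose b' : 'rV[R]_p := \row_i (b 0 i - d * (i == j)%:R + d * (i == k)%:R).
have bb' : T_step b b' by apply: T_step_transfer => //; lra.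
have sumb' (P : pred 'I_p) : \sum_(i | P i) b' 0 i =
    \sum_(i | P i) b 0 i - d * (P j)%:R + d * (P k)%:R.
  have delta (l : 'I_p) : \sum_(i | P i) (i == l)%:R = (P l)%:R :> R.
    case: (boolP (P l)) => Pl.
      by rewrite (bigD1 l) //= eqxx big1 ?addr0 // => i /andP[_ /negPf->].
    by rewrite big1 // => i Pi; case: eqP Pl => // <-; rewrite Pi.
  under eq_bigr do rewrite mxE.
  by rewrite big_split sumrB -!mulr_sumr /= !delta.
apply: rt_trans (rt_step _ _ _ _ bb') _.
apply: IH.
(* Only [j] and [k] change, and both differed before; the one attaining the minimum [d] now agrees
   with [a]. *)
- apply: leq_trans cardN; apply: proper_card; apply/properP; split.
    apply/fintype.subsetP => i; rewrite !inE mxE.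
    have [->|ij] := eqVneq i j; first by rewrite (lt_eqF abj).
    have [->|ik] := eqVneq i k; first by rewrite (gt_eqF bak).
    by rewrite !mulr0 subr0 addr0.
  have [dE|dE] : d = b 0 j - a 0 j \/ d = a 0 k - b 0 k.
    by rewrite /d; case: leP; [left|right].
  + exists j; first by rewrite inE (lt_eqF abj).
    rewrite inE mxE eqxx (negPf neq_jk) negbK dE mulr1 mulr0 addr0.
    by rewrite subKr.
  + exists k; first by rewrite inE (gt_eqF bak).
    rewrite inE mxE eqxx [k == j]eq_sym (negPf neq_jk) negbK dE mulr1 mulr0 subr0.
    by rewrite subrKC.
- move=> K Kp; rewrite sumb'.
  have [Kj|jK] := leqP K j.
    rewrite [(k < K)%N]ltnNge (leq_trans Kj (ltnW jk)) /= !mulr0 subr0 addr0.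
    exact: le_ab.
  have [Kk|kK] := leqP K k; last by rewrite subrK; apply: le_ab.
  (* For [j < K <= k] the prefix has lost [d]. The surplus of [b] over [a] at [j] covers this loss;
     the surplus before [j] is nonnegative by [le_ab], and the one after [j] by minimality of
     [k]. *)
  rewrite mulr0 addr0 mulr1 lerBrDr -lerBrDl -sumrB.
  rewrite (bigID (fun i : 'I_p => (i < j)%N)) /= [X in _ + X](bigD1 j) ?ltnn ?jK //=.
  rewrite addrCA -[leLHS]addr0 lerD // addr_ge0 //.
    rewrite (eq_bigl (fun i : 'I_p => (i < j)%N)); last first.
      move=> i; rewrite andbC; case: ltnP => //= ij.
      exact: ltn_trans ij jK.
    (* [le_ab] starts at length 1, so the empty prefix is treated apart. *)
    rewrite sumrB subr_ge0; case: (posnP j) => [->|j1]; first by rewrite !big_pred0.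
    by apply: le_ab; rewrite j1 ltnW.
  apply: sumr_ge0 => i /andP[/andP[iK _] _].
  by rewrite subr_ge0 kmin // (leq_trans iK).
- by rewrite sumb' /= subrK.
Qed.

(** The path runs from [z] to [decr_rearr z], then to [decr_rearr x], then to [x]; its two ends are
    permutations. *)
Lemma majorized_T_steps {R : realType} {p : nat} (x z : 'rV[R]_p) :
  majorized x z -> clos_refl_trans _ T_step z x.
Proof.
move=> [le_xz eq_xz].
have [s xs] := decr_rearrP x; have [t zt] := decr_rearrP z.
apply: rt_trans (T_steps_perm t z) _; rewrite -zt.
apply: (@rt_trans _ _ _ (decr_rearr x)).
  by apply: prefix_sum_le_T_steps => //; apply: decr_rearr_antitone.
rewrite -[X in clos_refl_trans _ _ _ X](col_perm1 x) -(mulVg s) col_permM -xs.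
exact: T_steps_perm.
Qed.

(** * Sequences of block T-transforms *)

Lemma block_T_obtained_refl {R : realType} {n m : nat} (a : 'rV[R]_(n + m)) :
  block_T_obtained a a.
Proof. by exists [::]. Qed.

Lemma block_T_obtained_trans {R : realType} {n m : nat}
    (a b c : 'rV[R]_(n + m)) :
  block_T_obtained b c -> block_T_obtained a b -> block_T_obtained a c.
Proof.
move=> [Ts [bTs ->]] [Us [bUs ->]]; exists (Ts ++ Us); rewrite foldl_cat.
by split=> //; apply/List.Forall_app.
Qed.

Lemma block_T_obtained_left {R : realType} {n m : nat} (b a : 'rV[R]_n)
    (v : 'rV[R]_m) :
  clos_refl_trans _ T_step b a ->
  block_T_obtained (row_mx a v) (row_mx b v).
Proof.
elim=> [{}b {}a /T_step_transform[A [TA ->]]|{}b|{}b c {}a _ ? _ ?].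
- exists [:: (mulmxr (block_mx A 0 0 1%:M) : {linear _ -> _})].
  split; last by rewrite /= mul_row_block !mulmx0 mulmx1 addr0 add0r.
  constructor=> //; left; exists (mulmxr A); split=> // ? ?.
  by rewrite /mulmxr /= mul_row_block !mulmx0 mulmx1 addr0 add0r.
- exact: block_T_obtained_refl.
- by apply: (@block_T_obtained_trans _ _ _ _ (row_mx c v)).
Qed.

Lemma block_T_obtained_right {R : realType} {n m : nat} (b a : 'rV[R]_m)
    (u : 'rV[R]_n) :
  clos_refl_trans _ T_step b a ->
  block_T_obtained (row_mx u a) (row_mx u b).
Proof.
elim=> [{}b {}a /T_step_transform[A [TA ->]]|{}b|{}b c {}a _ ? _ ?].
- exists [:: (mulmxr (block_mx 1%:M 0 0 A) : {linear _ -> _})].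
  split; last by rewrite /= mul_row_block !mulmx0 mulmx1 addr0 add0r.
  constructor=> //; right; exists (mulmxr A); split=> // ? ?.
  by rewrite /mulmxr /= mul_row_block !mulmx0 mulmx1 addr0 add0r.
- exact: block_T_obtained_refl.
- by apply: (@block_T_obtained_trans _ _ _ _ (row_mx u c)).
Qed.

(** * Convex hull of the block permutations *)

(** Trades the bundled interval coefficients of [convex_set] for a real [t] with explicit bounds. *)
Lemma convex_setP {R : realType} {E : lmodType R} (C : set E) :
  @convex_set R E C <->
  forall (a b : E) (t : R), 0 <= t <= 1 -> C a -> C b ->
    C (t *: a + (1 - t) *: b).
Proof.
split=> [cC a b t /andP[t0 t1] Ca Cb|cC a b t /set_mem Ca /set_mem Cb].
  by have /set_mem := cC a b (Itv01 t0 t1) (mem_set Ca) (mem_set Cb).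
apply/mem_set; apply: cC => //; apply/andP; split.
  exact: ge0.
exact: le1.
Qed.

Lemma convex_hull_convex {R : realType} {E : lmodType R} (A : set E) :
  @convex_set R E (convex_hull A).
Proof.
apply/convex_setP => a b t t01 Ha Hb C [cC AC].
by move/convex_setP: (cC); apply=> //; [apply: Ha|apply: Hb].
Qed.

(** The block permutation [f] is linear, so the preimage of the hull under [f] is convex; it
    contains the generators, hence the whole hull. *)
Lemma convex_hull_block_perm {R : realType} {n m : nat} (z : 'rV[R]_n)
    (w : 'rV[R]_m) (u : 'rV[R]_n) (v : 'rV[R]_m) (s : 'S_n) (t : 'S_m) :
  convex_hull (block_permutations z w) (row_mx u v) ->
  convex_hull (block_permutations z w) (row_mx (col_perm s u) (col_perm t v)).
Proof.
set H := convex_hull _.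
pose f (a : 'rV[R]_(n + m)) :=
  row_mx (col_perm s (lsubmx a)) (col_perm t (rsubmx a)).
have fD (c d : R) a b : f (c *: a + d *: b) = c *: f a + d *: f b.
  rewrite /f !scale_row_mx add_row_mx.
  by congr row_mx; apply/rowP => i; rewrite !mxE.
suff sub : H `<=` f @^-1` H.
  by move=> /sub; rewrite /f /= row_mxKl row_mxKr.
apply: smallest_sub.
  apply/convex_setP => a b c c01 Ha Hb; rewrite /preimage /= fD.
  by move/convex_setP: (@convex_hull_convex R _ (block_permutations z w)); apply.
move=> _ [s' [t' ->]]; apply: sub_gen_smallest.
exists (s * s')%g, (t * t')%g.
by rewrite /f row_mxKl row_mxKr !col_permM.
Qed.

Lemma convex_hull_block_T {R : realType} {n m : nat} (z : 'rV[R]_n)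
    (w : 'rV[R]_m) (T : {linear 'rV[R]_(n + m) -> 'rV[R]_(n + m)})
    (v : 'rV[R]_(n + m)) :
  block_T_transform T ->
  convex_hull (block_permutations z w) v ->
  convex_hull (block_permutations z w) (T v).
Proof.
have /convex_setP cH := @convex_hull_convex R _ (block_permutations z w).
rewrite -(hsubmxK v); set u1 := lsubmx v; set u2 := rsubmx v.
move=> [] [S [/T_transform_step[j [k [t [t01 SE]]]] TE]] Hv; rewrite TE SE.
- have -> : row_mx (t *: u1 + (1 - t) *: col_perm (tperm j k) u1) u2 =
     t *: row_mx u1 u2 + (1 - t) *: row_mx (col_perm (tperm j k) u1) (col_perm 1 u2).
    by rewrite !scale_row_mx add_row_mx col_perm1 -scalerDl subrKC scale1r.
  by apply: cH => //; apply: convex_hull_block_perm.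
- have -> : row_mx u1 (t *: u2 + (1 - t) *: col_perm (tperm j k) u2) =
     t *: row_mx u1 u2 + (1 - t) *: row_mx (col_perm 1 u1) (col_perm (tperm j k) u2).
    by rewrite !scale_row_mx add_row_mx col_perm1 -scalerDl subrKC scale1r.
  by apply: cH => //; apply: convex_hull_block_perm.
Qed.

Lemma block_T_obtained_convex_hull {R : realType} {n m : nat} (z : 'rV[R]_n)
    (w : 'rV[R]_m) (v : 'rV[R]_(n + m)) :
  block_T_obtained v (row_mx z w) -> convex_hull (block_permutations z w) v.
Proof.
move=> [Ts [bTs ->]].
have : convex_hull (block_permutations z w) (row_mx z w).
  by apply: sub_gen_smallest; exists 1%g, 1%g; rewrite !col_perm1.
elim: bTs (row_mx z w) => //= T {}Ts bT _ IH v' Hv'.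
by apply: IH; apply: convex_hull_block_T.
Qed.

Lemma convex_hull_doubly_stochastic {R : realType} {n m : nat} (z : 'rV[R]_n)
    (w : 'rV[R]_m) (v : 'rV[R]_(n + m)) :
  convex_hull (block_permutations z w) v ->
  exists (A1 : 'M[R]_n) (A2 : 'M[R]_m),
    [/\ doubly_stochastic A1, doubly_stochastic A2 &
     v^T = block_mx A1 0 0 A2 *m (row_mx z w)^T].
Proof.
move: v; apply: smallest_sub.
  apply/convex_setP => a b t t01 [A1 [A2 [dA1 dA2 aE]]] [B1 [B2 [dB1 dB2 bE]]].
  exists (t *: A1 + (1 - t) *: B1), (t *: A2 + (1 - t) *: B2).
  split; [exact: doubly_stochastic_conv..|].
  rewrite linearD !linearZ /= aE bE !scalemxAl -mulmxDl.
  by rewrite !scale_block_mx add_block_mx !scaler0 !addr0.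
move=> _ [s [t ->]]; exists (perm_mx s), (perm_mx t).
split; [exact: doubly_stochastic_perm..|].
(* [col_perm s] multiplies on the right by the matrix of the inverse of [s]; transposing inverts
   once more and leaves [perm_mx s]. *)
rewrite !tr_row_mx mul_block_col !mul0mx addr0 add0r !col_permE !trmx_mul.
by rewrite !tr_perm_mx !invgK.
Qed.

Theorem theorem2p6 (R : realType) (n m : nat)
    (x z : 'rV[R]_n) (y w : 'rV[R]_m) :
  [<-> majorized x z /\ majorized y w;
       block_T_obtained (row_mx x y) (row_mx z w);
       convex_hull (block_permutations z w) (row_mx x y);
       exists (A1 : 'M[R]_n) (A2 : 'M[R]_m),
         [/\ doubly_stochastic A1, doubly_stochastic A2 &
          (row_mx x y)^T = block_mx A1 0 0 A2 *m (row_mx z w)^T]].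
Proof.
tfae.
- move=> [/majorized_T_steps zx /majorized_T_steps wy].
  (* The first block is transformed while [w] is kept, then the second while [x] is kept. *)
  apply: (@block_T_obtained_trans _ _ _ _ (row_mx x w)).
    exact: block_T_obtained_left.
  exact: block_T_obtained_right.
- exact: block_T_obtained_convex_hull.
- exact: convex_hull_doubly_stochastic.
- move=> [A1 [A2 [dA1 dA2]]].
  rewrite !tr_row_mx mul_block_col !mul0mx addr0 add0r => /eq_col_mx[xE yE].
  by split; [apply: doubly_stochastic_majorized xE|
             apply: doubly_stochastic_majorized yE].
Qed.
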